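(* Let $q\ge2$ be an integer and let $(T_n)_{n\ge0}$ be defined by $T_0=\dots=T_{q-2}=0$, $T_{q-1}=1$ and $T_{n+q}=T_{n+q-1}+T_{n+q-2}+\dots+T_n$ for $n\ge0$. Let $(U_n)_{n\ge0}$ be defined by $U_0=0$, $U_i=2^{i-1}$ for $i=1,\dots,q-1$, and $U_{n+q}=U_{n+q-1}+U_{n+q-2}+\dots+U_n$ for $n\ge0$. Then $$T_n=c_{n-q+1}(1,2,\dots,q)\quad(n\ge q),\qquad U_n=c_n\big(1,2,\dots,q-1\ (\mathrm{mod}\ q)\big)\quad(n\ge1).$$
   Context: A composition of $m$ with parts in a set $S$ of positive integers is an ordered tuple of elements of $S$ summing to $m$; $c_m(S)$ denotes their number. Here $c_m(1,2,\dots,q)$ counts compositions with parts in $\{1,\dots,q\}$, and $c_m(1,2,\dots,q-1\ (\mathrm{mod}\ q))$ counts compositions all of whose parts are congruent to one of $1,2,\dots,q-1$ modulo $q$ (i.e., no part is divisible by $q$). *)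

(* Defs.v *)
From mathcomp Require Import all_boot.

Set Implicit Arguments.
Unset Strict Implicit.
Unset Printing Implicit Defensive.

Definition is_composition (S : pred nat) (m : nat) (s : seq nat) : bool :=
  all (fun i => (0 < i) && S i) s && (sumn s == m).

(* Parts are positive, so a composition of m has at most m parts, each at most
   m: the finite type of sequences of length at most m over {0, ..., m}
   contains all of them (is_composition_bseq below). *)
Definition ncompositions (S : pred nat) (m : nat) : nat :=
  #|[set s : m.-bseq 'I_m.+1 | is_composition S m [seq val i | i <- s]]|.

Lemma is_composition_bseq (S : pred nat) (m : nat) (s : seq nat) :
  is_composition S m s ->
  exists! t : m.-bseq 'I_m.+1, [seq val i | i <- t] = s.
Proof.
case/andP=> /allP sP /eqP sm.
have le_size : size s <= m.
  rewrite -sm; elim: s sP {sm} => //= i s IHs sP.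
  have /andP[i_gt0 _] := sP i (mem_head i s).
  by rewrite -add1n leq_add // IHs // => j sj; rewrite sP // inE sj orbT.
have le_part i : i \in s -> i <= m.
  rewrite -sm; elim: s {sP sm le_size} => //= j s IHs.
  rewrite inE => /orP[/eqP->|/IHs le_is]; first exact: leq_addr.
  exact: leq_trans le_is (leq_addl _ _).
have sz : size [seq (inord i : 'I_m.+1) | i <- s] <= m by rewrite size_map.
have valK : [seq val i | i <- Bseq sz] = s.
  rewrite /= -map_comp -[RHS]map_id; apply/eq_in_map => i /le_part le_im /=.
  by rewrite inordK.
exists (Bseq sz); split=> // t ts; apply/val_inj/(inj_map val_inj).
by rewrite ts valK.
Qed.

Definition parts_upto (q : nat) : pred nat := [pred i | 1 <= i <= q].

Definition parts_mod (q : nat) : pred nat :=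
  [pred i | has (fun r => i == r %[mod q]) (iota 1 q.-1)].

(* Main.v *)
Require Import Defs.
From mathcomp Require Import all_boot.
From mathcomp Require Import zify.

(* Removing the first part gives [c_m = sum_(i in S, 1 <= i <= m) c_(m-i)].
   For parts at most [q] this is the recurrence of [T], shifted by [q - 1].
   For parts not divisible by [q], the terms with [i > q] in the sum
   for [c_(m+q)] are the whole sum for [c_m], so they can be folded into the
   single term [c_m] (absent when [m = 0], which is why [U_0 = 0]). *)

(** Plain duplicate-free lists, so that two counts can be compared through [perm_eq], by membership
    alone. *)
Definition compositions (S : pred nat) (m : nat) : seq (seq nat) :=
  [seq [seq val i | i <- val t] | t <- enum
    [set s : m.-bseq 'I_m.+1 | is_composition S m [seq val i | i <- s]]].

Lemma size_compositions S m : size (compositions S m) = ncompositions S m.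
Proof. by rewrite size_map -cardE. Qed.

Lemma uniq_compositions S m : uniq (compositions S m).
Proof.
rewrite map_inj_uniq ?enum_uniq // => t u /(inj_map val_inj) tu.
exact: val_inj.
Qed.

Lemma mem_compositions S m s :
  (s \in compositions S m) = is_composition S m s.
Proof.
apply/mapP/idP => [[t + ->]|Ss]; first by rewrite mem_enum inE.
have [t [ts _]] := is_composition_bseq Ss.
by exists t; rewrite // mem_enum inE ts.
Qed.

Lemma ncompositions0 S : ncompositions S 0 = 1.
Proof.
rewrite -size_compositions.
suff /perm_size -> : perm_eq (compositions S 0) [:: [::]] by [].
apply: uniq_perm; rewrite ?uniq_compositions // => -[|i s].
  by rewrite mem_compositions.
rewrite mem_compositions inE /is_composition /=.
by apply/negP => /andP[/andP[/andP[i_gt0 _] _]]; rewrite addn_eq0; case: i i_gt0.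
Qed.

Lemma ncompositionsS S m :
  ncompositions S m.+1 =
  \sum_(0 <= i < m.+1 | S i.+1) ncompositions S (m - i).
Proof.
rewrite -size_compositions.
(* An index [i] stands for the first part [i.+1], which leaves [m - i] to compose. *)
pose heads := [seq i <- iota 0 m.+1 | S i.+1].
pose extensions :=
  [seq (i.+1 :: s : seq nat) | i <- heads, s <- compositions S (m - i)].
suff /perm_size -> : perm_eq (compositions S m.+1) extensions.
  rewrite size_allpairs_dep sumnE big_map big_filter /index_iota subn0.
  by apply: eq_bigr => i _; rewrite size_compositions.
apply: uniq_perm; rewrite ?uniq_compositions //.
  apply: allpairs_uniq_dep; first by rewrite filter_uniq ?iota_uniq.
    by move=> i _; exact: uniq_compositions.
  by move=> [i s] [j t] _ _ [-> ->].
move=> s; rewrite mem_compositions; apply/idP/allpairsPdep => [|].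
  case: s => [|[|i] s] /andP[] //= /andP[Si Ss] /eqP sm.
  exists i, s; split=> //; first by rewrite mem_filter Si mem_iota; lia.
  by rewrite mem_compositions /is_composition Ss; apply/eqP; lia.
move=> [i [t [+ + ->]]]; rewrite mem_filter mem_iota mem_compositions.
move=> /andP[Si im] /andP[St /eqP tm].
by rewrite /is_composition /= Si St; apply/eqP; lia.
Qed.

Lemma parts_modE q : 0 < q -> parts_mod q =1 [pred i | ~~ (q %| i)].
Proof.
move=> q_gt0 i /=; apply/hasP/idP => [[r]|qi].
  rewrite mem_iota => r_bound /eqP ir; apply/negP.
  by rewrite /dvdn ir modn_small; lia.
exists (i %% q); last by rewrite modn_mod.
by rewrite mem_iota; have := ltn_pmod i q_gt0; move: qi; rewrite /dvdn; lia.
Qed.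

(** The shift puts [T (q - 1) = 1] at the empty composition; the initial zeros of [T] play the
    counts for negative totals. *)
Lemma ncompositions_upto q T :
    1 < q -> (forall i, i <= q - 2 -> T i = 0) -> T (q - 1) = 1 ->
    (forall n, T (n + q) = \sum_(0 <= j < q) T (n + j)) ->
  forall n, T (n + (q - 1)) = ncompositions (parts_upto q) n.
Proof.
move=> q_gt1 T0 T1 Trec n; elim/ltn_ind: n => -[|n] IHn.
  by rewrite ncompositions0.
have -> : n.+1 + (q - 1) = n + q by lia.
rewrite Trec ncompositionsS big_nat_rev /=.
(* For [j > n] the index of [T] is at most [q - 2], so the term vanishes. *)
transitivity (\sum_(0 <= j < q | j < n.+1) ncompositions (parts_upto q) (n - j)).
  rewrite [RHS]big_mkcond; apply: eq_big_nat => j /andP[_ jq].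
  case: ltnP => jn; last by apply: T0; lia.
  by rewrite -IHn; [congr T; lia | lia].
(* Over a common range, the bounds [j < q] and [j < n.+1] become two conditions in either order. *)
rewrite (big_nat_widen _ _ (q + n.+1)) ?leq_addr //.
rewrite [RHS](big_nat_widen _ _ (q + n.+1)) ?leq_addl //.
by apply: eq_bigl => j; rewrite /= andbC.
Qed.

Section PartsMod.
Variables (q : nat) (q_gt0 : 0 < q).
Let d := ncompositions (parts_mod q).
(** The closed form of [U]: at 0 the empty composition is discarded. *)
Let d_pos n := if n is 0 then 0 else d n.

Lemma ncompositions_modE n :
  \sum_(0 <= i < n | ~~ (q %| i.+1)) d (n - i.+1) = d_pos n.
Proof.
case: n => [|n]; first by rewrite big_geq.
by rewrite /d_pos /d ncompositionsS; apply: eq_bigl => i; rewrite parts_modE.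
Qed.

Lemma ncompositions_mod_rec n :
  d_pos (n + q) = \sum_(0 <= j < q) d_pos (n + j).
Proof.
rewrite -ncompositions_modE (@big_cat_nat _ _ _ q) ?leq_addl //=.
(* Shifting a part by [q] preserves non-divisibility. *)
have -> : \sum_(q <= i < n + q | ~~ (q %| i.+1)) d (n + q - i.+1) = d_pos n.
  rewrite -{1}[q]add0n big_addn addnK -ncompositions_modE.
  by apply: eq_big => [i|i _]; [rewrite -addSn dvdn_addl | congr d; lia].
(* The term [i = q - 1] is the forbidden part [q]; the others match under [j = q - 1 - i], with
   positive arguments, where [d_pos] is [d]. *)
have -> : \sum_(0 <= i < q | ~~ (q %| i.+1)) d (n + q - i.+1) =
          \sum_(1 <= j < q) d_pos (n + j).
  rewrite -(prednK q_gt0) [LHS]big_mkcond big_nat_recr //= dvdnn addn0.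
  rewrite big_add1 /= [RHS]big_nat_rev; apply: eq_big_nat => i /andP[_ iq].
  rewrite gtnNdvd //=.
  have -> : n + (0 + q.-1 - i.+1).+1 = (n + q.-1.+1 - i.+2).+1 by lia.
  by rewrite /d_pos; congr d; lia.
by rewrite [RHS]big_ltn // addn0 addnC.
Qed.

(** Below [q] every part is allowed, so each value is the sum of all earlier ones, from [d 0 = 1],
    and hence doubles. *)
Lemma ncompositions_mod_small n : n.+1 < q -> d n.+1 = 2 ^ n.
Proof.
have sumE m : m.+1 < q -> d m.+1 = \sum_(0 <= j < m.+1) d j.
  move=> mq; rewrite /d ncompositionsS [RHS]big_nat_rev big_mkcond /=.
  apply: eq_big_nat => i /andP[_ im].
  rewrite parts_modE //= gtnNdvd //; lia.
elim: n => [|n IHn] nq; first by rewrite sumE // big_nat1 /d ncompositions0.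
by rewrite sumE // big_nat_recr //= -sumE ?IHn ?expnS; lia.
Qed.
End PartsMod.

Theorem theorem8 (q : nat) (T U : nat -> nat)
  (hq : 2 <= q)
  (T_init0 : forall i, i <= q - 2 -> T i = 0)
  (T_init1 : T (q - 1) = 1)
  (T_rec : forall n, T (n + q) = \sum_(0 <= j < q) T (n + j))
  (U_init0 : U 0 = 0)
  (U_init : forall i, 1 <= i <= q - 1 -> U i = 2 ^ (i - 1))
  (U_rec : forall n, U (n + q) = \sum_(0 <= j < q) U (n + j)) :
  (forall n, q <= n -> T n = ncompositions (parts_upto q) (n - q + 1)) /\
  (forall n, 1 <= n -> U n = ncompositions (parts_mod q) n).
Proof.
split=> [n qn|].
  rewrite -(ncompositions_upto q T hq T_init0 T_init1 T_rec).
  by congr T; lia.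
have q_gt0 : 0 < q by lia.
(* The induction must include [n = 0], since the recurrence for [U q] reaches [U 0]. *)
suff UE n : U n = if n is 0 then 0 else ncompositions (parts_mod q) n.
  by case=> // n _; rewrite UE.
elim/ltn_ind: n => n IHn; case: (leqP q n) => [qn|nq].
  rewrite -(subnK qn) U_rec ncompositions_mod_rec //.
  by apply: eq_big_nat => j /andP[_ jq]; apply: IHn; lia.
case: n nq {IHn} => // n nq.
by rewrite U_init ?subn1 ?ncompositions_mod_small //; lia.
Qed.
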